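(* Let $p$ be a prime number with $p\equiv 7 \pmod 8$, let $R=\mathbb Z_2[X]/(X^2+p)$, and let $n\ge 1$ be an integer. Then the number of isomorphism classes of self-dual skew-Hermitian modules over $R$ of $\mathbb Z_2$-rank $2n$ is $$\sum_{r=0}^n m_r .$$
   Context: Write $R=\mathbb Z_2[X]/(X^2+p)=\mathbb Z_2[\pi]$, where $\pi$ is the image of $X$; it is an order in the $\mathbb Q_2$-algebra $E=\mathbb Q_2[X]/(X^2+p)$. Let $a\mapsto\bar a$ be the non-trivial involution of $E$ over $\mathbb Q_2$ (so $\bar\pi=-\pi$). A skew-Hermitian module over $R$ is a finitely generated $R$-module $M$ that is free over $\mathbb Z_2$, together with a non-degenerate alternating $\mathbb Z_2$-bilinear pairing $\psi:M\times M\to\mathbb Z_2$ such that $\psi(ax,y)=\psi(x,\bar a y)$ for all $a\in R$, $x,y\in M$. It is self-dual if $\psi$ induces an isomorphism $M\to \mathrm{Hom}_{\mathbb Z_2}(M,\mathbb Z_2)$. An isomorphism of skew-Hermitian modules is an $R$-linear isomorphism preserving the pairings. For $r\ge 1$ let $S_r$ be the set of symmetric matrices in $\mathrm{GL}_r(\mathbb F_2)$; for $A,B\in S_r$ write $A\sim B$ if there is $P\in\mathrm{GL}_r(\mathbb F_2)$ with $B=P^tAP$. Put $m_0:=1$ and $m_r:=\#(S_r/\!\sim)$ for $r\ge1$. *)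

(* Defs.v *)
From HB Require Import structures.
From mathcomp Require Import all_boot all_order all_algebra.
From mathcomp Require Import boolp.

Set Implicit Arguments.
Unset Strict Implicit.
Unset Printing Implicit Defensive.

Import GRing.Theory.
Local Open Scope ring_scope.

(* The 2-adic integers as lim Z/2^n: the n-th coordinate is the canonical     *)
(* remainder modulo 2^n, and the coherence condition also forces              *)
(* 0 <= x n < 2^n.                                                            *)
Definition coherent (x : nat -> int) : bool :=
  `[< forall n, x n = (x n.+1 %% 2 ^+ n)%Z >].

Record Z2 : Type := MkZ2 { Z2_res :> nat -> int; _ : coherent Z2_res }.

HB.instance Definition _ := [isSub for Z2_res].
HB.instance Definition _ := [Choice of Z2 by <:].

Lemma Z2_resE (x : Z2) n : x n = (x n.+1 %% 2 ^+ n)%Z.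
Proof. by case: x => x /= /asboolP. Qed.

Lemma Z2_res_mod (x : Z2) n : (x n %% 2 ^+ n)%Z = x n.
Proof. by rewrite Z2_resE modz_mod. Qed.

Lemma Z2_eqP (x y : Z2) : (forall n, x n = y n) -> x = y.
Proof. by move=> exy; apply/val_inj/funext. Qed.

Lemma modz_pow2S (a : int) n :
  ((a %% 2 ^+ n.+1)%Z %% 2 ^+ n)%Z = (a %% 2 ^+ n)%Z.
Proof. by rewrite [in RHS](divz_eq a (2 ^+ n.+1)) exprS mulrA modzMDl. Qed.

Fact Z2_of_subproof (x : nat -> int)
    (hx : forall n, (x n = x n.+1 %[mod 2 ^+ n])%Z) :
  coherent (fun n => (x n %% 2 ^+ n)%Z).
Proof. by apply/asboolP => n; rewrite modz_pow2S. Qed.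

Definition Z2_of x hx : Z2 := MkZ2 (@Z2_of_subproof x hx).

Lemma Z2_mod_next (x : Z2) n : (x n = x n.+1 %[mod 2 ^+ n])%Z.
Proof. by rewrite Z2_res_mod -Z2_resE. Qed.

Fact Z2_cst_subproof (a : int) n : (a = a %[mod 2 ^+ n])%Z.
Proof. by []. Qed.

Fact Z2_opp_subproof (x : Z2) n : (- x n = - x n.+1 %[mod 2 ^+ n])%Z.
Proof. by rewrite -modzNm Z2_mod_next modzNm. Qed.

Fact Z2_add_subproof (x y : Z2) n :
  (x n + y n = x n.+1 + y n.+1 %[mod 2 ^+ n])%Z.
Proof. by rewrite -modzDm !Z2_mod_next modzDm. Qed.

Fact Z2_mul_subproof (x y : Z2) n :
  (x n * y n = x n.+1 * y n.+1 %[mod 2 ^+ n])%Z.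
Proof. by rewrite -modzMm !Z2_mod_next modzMm. Qed.

Definition Z2_zero : Z2 := Z2_of (Z2_cst_subproof 0).
Definition Z2_one : Z2 := Z2_of (Z2_cst_subproof 1).
Definition Z2_opp (x : Z2) : Z2 := Z2_of (Z2_opp_subproof x).
Definition Z2_add (x y : Z2) : Z2 := Z2_of (Z2_add_subproof x y).
Definition Z2_mul (x y : Z2) : Z2 := Z2_of (Z2_mul_subproof x y).

Fact Z2_addA : associative Z2_add.
Proof. by move=> x y z; apply: Z2_eqP => n /=; rewrite modzDml modzDmr addrA. Qed.

Fact Z2_addC : commutative Z2_add.
Proof. by move=> x y; apply: Z2_eqP => n /=; rewrite addrC. Qed.

Fact Z2_add0 : left_id Z2_zero Z2_add.
Proof. by move=> x; apply: Z2_eqP => n /=; rewrite modzDml add0r Z2_res_mod. Qed.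

Fact Z2_addN : left_inverse Z2_zero Z2_opp Z2_add.
Proof. by move=> x; apply: Z2_eqP => n /=; rewrite modzDml addNr. Qed.

HB.instance Definition _ :=
  GRing.isZmodule.Build Z2 Z2_addA Z2_addC Z2_add0 Z2_addN.

Fact Z2_mulA : associative Z2_mul.
Proof. by move=> x y z; apply: Z2_eqP => n /=; rewrite modzMml modzMmr mulrA. Qed.

Fact Z2_mulC : commutative Z2_mul.
Proof. by move=> x y; apply: Z2_eqP => n /=; rewrite mulrC. Qed.

Fact Z2_mul1 : left_id Z2_one Z2_mul.
Proof. by move=> x; apply: Z2_eqP => n /=; rewrite modzMml mul1r Z2_res_mod. Qed.

Fact Z2_mulD : left_distributive Z2_mul +%R.
Proof.
by move=> x y z; apply: Z2_eqP => n /=; rewrite modzMml modzDm mulrDl.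
Qed.

Fact Z2_one_neq0 : Z2_one != 0.
Proof. by apply/eqP => /(congr1 (fun x : Z2 => x 1%N)). Qed.

HB.instance Definition _ := GRing.Zmodule_isComNzRing.Build Z2
  Z2_mulA Z2_mulC Z2_mul1 Z2_mulD Z2_one_neq0.

Definition X2p (p : nat) : {poly Z2} := 'X^2 + p%:R%:P.

Definition Rp (p : nat) : Type := {poly %/ X2p p}.
HB.instance Definition _ p := GRing.ComNzRing.on (Rp p).
HB.instance Definition _ p := GRing.Algebra.on (Rp p).

(* {poly %/ h} falls back to h := 'X unless h is monic and non-constant.      *)
Lemma mk_monic_X2p p : mk_monic (X2p p) = X2p p.
Proof.
have sC : (size (p%:R%:P : {poly Z2}) < size ('X^2 : {poly Z2}))%N.
  by rewrite size_polyXn (leq_ltn_trans (size_polyC_leq1 _)).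
by rewrite /mk_monic monicE lead_coefDl // lead_coefXn size_polyDl // size_polyXn
  eqxx.
Qed.

(* The restriction to R of the involution pi |-> - pi of E.                   *)
Definition Rconj (p : nat) (a : Rp p) : Rp p :=
  in_qpoly (X2p p) ((a : {poly Z2}) \Po (- 'X)).

Section RestrictionOfScalars.
Variables (p : nat) (M : lmodType (Rp p)).

Definition restr : Type := M.
HB.instance Definition _ := GRing.Zmodule.on restr.

Definition restr_scale (c : Z2) (x : restr) : restr := (c%:A : Rp p) *: (x : M).

Fact restr_scaleA a b x :
  restr_scale a (restr_scale b x) = restr_scale (a * b) x.
Proof. by rewrite /restr_scale scalerA -scalerAl mul1r scalerA. Qed.

Fact restr_scale1 : left_id 1 restr_scale.
Proof. by move=> x; rewrite /restr_scale !scale1r. Qed.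

Fact restr_scaleDr : right_distributive restr_scale +%R.
Proof. by move=> a x y; apply: scalerDr. Qed.

Fact restr_scaleDl x : {morph restr_scale^~ x : a b / a + b}.
Proof. by move=> a b; rewrite /restr_scale !scalerDl. Qed.

HB.instance Definition _ := GRing.Zmodule_isLmodule.Build Z2 restr
  restr_scaleA restr_scale1 restr_scaleDr restr_scaleDl.

End RestrictionOfScalars.

Definition finitely_generated (A : nzRingType) (M : lmodType A) : Prop :=
  exists (k : nat) (g : 'I_k -> M),
    forall x : M, exists c : 'I_k -> A, x = \sum_(i < k) c i *: g i.

Definition free_of_rank (A : nzRingType) (M : lmodType A) (k : nat) : Prop :=
  exists e : 'I_k -> M,
    forall x : M, exists! c : {ffun 'I_k -> A}, x = \sum_(i < k) c i *: e i.

Record skewHermMod (p : nat) : Type := SkewHermMod {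
  shmod :> lmodType (Rp p);
  shform : {biscalar (restr shmod)};
  shmod_fg : finitely_generated shmod;
  shmod_free : exists k, free_of_rank (restr shmod) k;
  shform_alt : forall x, shform x x = 0;
  shform_nondeg : forall x, (forall y, shform x y = 0) -> x = 0;
  shform_adj : forall (a : Rp p) (x y : shmod),
    shform (a *: x) y = shform x (Rconj a *: y)
}.

Definition self_dual (p : nat) (M : skewHermMod p) : Prop :=
  forall phi : {scalar (restr M)}, exists! x, shform M x =1 phi.

Definition sh_iso (p : nat) (M N : skewHermMod p) : Prop :=
  exists f : {linear M -> N}, bijective f /\
    forall x y, shform N (f x) (f y) = shform M x y.

(* The equivalence relation E has exactly N classes on { x | P x }, given by a *)
(* complete and irredundant system of representatives.  (The set of classes   *)
(* itself, of type set (set T), is out of reach for T := skewHermMod p because *)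
(* of a universe constraint between set and lmodType.)                        *)
Definition has_num_classes (T : Type) (P : T -> Prop) (E : T -> T -> Prop)
    (N : nat) : Prop :=
  exists rep : 'I_N -> T,
    [/\ forall i, P (rep i),
        forall i j, E (rep i) (rep j) -> i = j
      & forall x, P x -> exists i, E (rep i) x].

Definition symGL (r : nat) : {set 'M['F_2]_r} :=
  [set A | (A^T == A) && (A \in unitmx)].

Definition congruent_mx (r : nat) (A B : 'M['F_2]_r) : bool :=
  [exists P, (P \in unitmx) && (B == P^T *m A *m P)].

Definition m_ (r : nat) : nat :=
  if r is 0 then 1%N
  else #|equivalence_partition (@congruent_mx r) (symGL r)|.

(* Main.v *)
From HB Require Import structures.
Require Import Defs.
From mathcomp Require Import all_boot all_order all_algebra.
From mathcomp Require Import boolp zify ring.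

(** Since [p = 7 mod 8], [- p] is a square [s ^ 2] of a unit [s] of Z_2, so
    [pi] acts on a skew-Hermitian module [M] with the two eigenvalues [s] and
    [- s].  The identity [psi (pi x) y = - psi x (pi y)] makes each eigenspace
    isotropic.  When [M] is self-dual of rank [2 n], the [s]-eigenspace is a
    direct summand and a Lagrangian of rank [n]; choose a basis [e] of it and
    complete it to a symplectic basis [(e, f)].  In this basis
      [pi e = s e]   and   [pi f = - s f + B e]
    with [B] symmetric over Z_2, and every symmetric [B] occurs
    ([normal_form], [std_skew_pair]).

    An isomorphism between two such modules preserves the [s]-eigenspace, so
    it is block triangular: it changes [B] by a congruence over Z_2 and, since
    [f] may be moved along [e], by the addition of [2 s S] with [S] symmetric
    and arbitrary.  As a matrix over Z_2 is invertible when it is so modulo 2,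
    the isomorphism class of [M] is exactly the congruence class of [B] modulo
    2 ([std_isometry_congruent], [congruent_std_isometry]).

    There remain the symmetric [n x n] matrices over F_2 up to congruence.
    Splitting off the radical shows that each is congruent to an invertible
    symmetric matrix of size [r <= n] bordered by zeros, where [r] and the
    class of the invertible block are invariants ([sym_reps]); this gives the
    sum of the [m_ r].

    Modules are handled through matrices: a basis of [M] turns it into a pair
    [(J, T)], the Gram matrix of the form and the matrix of [pi], acting on
    row vectors on the right ([mxSkewHerm], [self_dual_matrix]). *)

Set Implicit Arguments.
Unset Strict Implicit.
Unset Printing Implicit Defensive.

Import GRing.Theory Num.Theory.
Local Open Scope ring_scope.

(** * The 2-adic integers *)

Lemma Z2_res_dvd (x : Z2) n m : (2 ^+ n %| x (m + n)%N - x n)%Z.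
Proof.
elim: m => [|m IHm]; first by rewrite subrr.
rewrite (_ : _ - _ = x (m.+1 + n)%N - x (m + n)%N + (x (m + n)%N - x n)); last by ring.
rewrite rpredD ?IHm //; apply: (@dvdz_trans (2 ^+ (m + n))).
  by rewrite dvdz_exp2l // leq_addl.
by rewrite -eqz_mod_dvd addSn -Z2_mod_next.
Qed.

Lemma Z2_res2 (x : Z2) n : (x n.+1 %% 2)%Z = x 1%N.
Proof.
rewrite -[RHS]Z2_res_mod; apply/eqP; rewrite eqz_mod_dvd.
by have := Z2_res_dvd x 1 n; rewrite addn1.
Qed.

Lemma Z2_natE (k n : nat) : (k%:R : Z2) n = (k%:Z %% 2 ^+ n)%Z.
Proof.
elim: k => [|k IHk] //; rewrite mulrSr /= IHk modzDm; congr (modz _ _); lia.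
Qed.

Lemma Z2_double_eq0 (x : Z2) : x + x = 0 -> x = 0.
Proof.
move=> x2; apply: Z2_eqP => n; have /= := congr1 (fun z : Z2 => z n.+1) x2.
rewrite mod0z => /dvdz_mod0P.
have -> : x n.+1 + x n.+1 = 2 * x n.+1 by ring.
rewrite exprS dvdz_mul2l // => h.
by rewrite Z2_resE mod0z; apply/dvdz_mod0P.
Qed.

Definition red (x : Z2) : 'F_2 := (x 1%N)%:~R.

Lemma F2_intr_mod (a : int) : ((a %% 2)%Z)%:~R = a%:~R :> 'F_2.
Proof.
rewrite [in RHS](divz_eq a 2) (intrD _ (_ * _)) (intrM _ _ 2).
have -> : (2%:~R : 'F_2) = 0 by apply: val_inj.
by rewrite mulr0 add0r.
Qed.

Fact red_is_zmod_morphism : zmod_morphism red.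
Proof.
move=> x y; rewrite /red /= expr1 F2_intr_mod intrD F2_intr_mod.
by rewrite mulrNz.
Qed.

Fact red_is_monoid_morphism : monoid_morphism red.
Proof. by split=> [|x y] //; rewrite /red /= expr1 F2_intr_mod intrM. Qed.

HB.instance Definition _ := GRing.isZmodMorphism.Build Z2 'F_2 red red_is_zmod_morphism.
HB.instance Definition _ := GRing.isMonoidMorphism.Build Z2 'F_2 red red_is_monoid_morphism.

(** Halving the residues shifts the precision by one: the residue of [x / 2]
    modulo [2 ^ n] is read off from [x] modulo [2 ^ n.+1]. *)
Lemma red_eq0 (x : Z2) : red x = 0 -> exists y, x = y + y.
Proof.
move=> x0.
have x1 : x 1%N = 0.
  have := Z2_res2 x 0; have := modz_ge0 (x 1%N) (_ : (2 : int) != 0) => /(_ isT).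
  have := ltz_pmod (x 1%N) (_ : (0 < 2 :> int)) => /(_ isT).
  move=> h1 h2 h3; rewrite h3 in h1 h2; move: x0 h1 h2; rewrite /red.
  by case: (x 1%N) => [[|[|n]]|n].
have ev n : (2 %| x n.+1)%Z by apply/dvdz_mod0P; rewrite Z2_res2.
have co n : ((x n.+1 %/ 2)%Z = (x n.+2 %/ 2)%Z %[mod 2 ^+ n])%Z.
  apply/eqP; rewrite eqz_mod_dvd -(@dvdz_mul2l 2) // -exprS mulrBr ![2 * _]mulrC !divzK //.
  by rewrite -eqz_mod_dvd; apply/eqP/Z2_mod_next.
exists (Z2_of co); apply: Z2_eqP => n /=.
rewrite modzDm (_ : _ + _ = (x n.+1 %/ 2)%Z * 2); last by ring.
by rewrite divzK // -Z2_resE.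
Qed.

(** Inverses modulo the powers of 2 exist by Bezout, and they are coherent
    because an inverse is unique modulo [2 ^ n]. *)
Lemma Z2_inv (x : Z2) : red x != 0 -> exists y, x * y = 1.
Proof.
move=> x0.
have odd n : gcdz (x n) (2 ^+ n) = 1.
  apply/eqP; case: n => [|n]; first by rewrite expr0 /gcdz gcdn1.
  rewrite -/(coprimez _ _) coprimezE abszX coprimeXr // coprime_sym prime_coprime //.
  apply: contraNN x0; rewrite -/(dvdz 2 _) => /dvdz_mod0P.
  by rewrite Z2_res2 /red => ->.
have /choice [y yP] n : exists u, (x n * u = 1 %[mod 2 ^+ n])%Z.
  have [u [v uv]] := Bezoutz (x n) (2 ^+ n); exists u.
  apply/eqP; rewrite eqz_mod_dvd; apply/dvdzP; exists (- v).
  rewrite -[X in _ - X](odd n) -uv; ring.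
have co n : (y n = y n.+1 %[mod 2 ^+ n])%Z.
  apply/eqP; rewrite eqz_mod_dvd.
  have h1 := yP n; have h2 := yP n.+1; have h3 := Z2_mod_next x n.
  move/eqP: h1; move/eqP: h2; move/eqP: h3; rewrite !eqz_mod_dvd exprS.
  move=> h3 /(dvdz_trans (dvdz_mull 2 (dvdzz _))) h2 h1.
  rewrite (_ : y n - y n.+1 = - (x n.+1 * y n.+1 - 1) * y n + y n.+1 * (x n * y n - 1)
      - (x n - x n.+1) * y n * y n.+1); last by ring.
  apply: rpredB; [apply: rpredD|]; rewrite ?mulNr ?rpredN -?mulrA; first exact: dvdz_mulr.
    exact: dvdz_mull.
  exact: dvdz_mulr.
exists (Z2_of co); apply: Z2_eqP => n /=.
by rewrite modzMmr yP.
Qed.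

(** Hensel lifting at the prime 2: an approximate root known modulo
    [2 ^ n.+3] is corrected by [2 ^ n.+2], one bit less than the precision
    because the derivative [2 r] is even.  Hence the residue modulo 8 decides. *)
Lemma Z2_sqrt (p : nat) : p = 7 %[mod 8] -> exists s : Z2, s * s = - p%:R.
Proof.
move=> p7.
have {}p7 : (8 %| 1 + p%:Z)%Z by lia.
pose P n (r : int) := (2 ^+ n.+3 %| r * r + p%:Z)%Z && ~~ (2 %| r)%Z.
have step n r : P n r -> exists r', P n.+1 r' /\ (r = r' %[mod 2 ^+ n])%Z.
  case/andP => /dvdzP [q qE] ro.
  have [/dvdzP [k kE]|qo] := boolP (2 %| q)%Z.
    exists r; split => //; rewrite /P ro andbT; apply/dvdzP; exists k.
    rewrite qE kE [in RHS]exprS; ring.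
  exists (r + 2 ^+ n.+2); split; last first.
    have -> : (2 : int) ^+ n.+2 = 4 * 2 ^+ n by rewrite !exprS mulrA.
    by rewrite addrC modzMDl.
  rewrite /P; apply/andP; split; last first.
    by rewrite rpredDr // exprS dvdz_mulr.
  (* The correction changes [q] into [q + r] modulo 2, a sum of odd numbers. *)
  have /dvdzP [k kE] : (2 %| q + r)%Z by lia.
  apply/dvdzP; exists (k + 2 ^+ n).
  rewrite (_ : _ + _ = (r * r + p) + 2 * 2 ^+ n.+2 * r + 2 ^+ n.+2 * 2 ^+ n.+2); last by ring.
  rewrite qE [RHS]mulrDl.
  have -> : k * 2 ^+ n.+4 = (q + r) * 2 ^+ n.+3 by rewrite kE [in LHS]exprS; ring.
  rewrite -exprS [in RHS]mulrDl; congr (_ + _ + _); first by rewrite mulrC.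
  by rewrite -!exprD; congr (_ ^+ _); lia.
(* The precision is carried along with the approximation, so that dependent
   choice reduces to iterating a function. *)
have [r rP] : exists r : nat -> int, forall n, P n (r n) /\ (r n = r n.+1 %[mod 2 ^+ n])%Z.
  have r0 : P 0%N 1 by rewrite /P mulr1 p7.
  have /choice [F FP] (x : {u : nat * int | P u.1 u.2}) :
    exists y : {u : nat * int | P u.1 u.2},
      (val y).1 = (val x).1.+1 /\ ((val x).2 = (val y).2 %[mod 2 ^+ (val x).1])%Z.
    case: x => [[n r] /= /step [r' [rP' e]]].
    by exists (exist _ (n.+1, r') rP').
  pose X n := iter n F (exist _ (0%N, 1) r0).
  have XE n : (val (X n)).1 = n by elim: n => //= n IHn; rewrite (FP _).1 IHn.
  exists (fun n => (val (X n)).2) => n; split.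
    by move: (valP (X n)); rewrite XE.
  by have [_] := FP (X n); rewrite XE.
have co n : (r n = r n.+1 %[mod 2 ^+ n])%Z by case: (rP n).
exists (Z2_of co); apply: Z2_eqP => n /=.
rewrite modzMm; have [/andP [h _] _] := rP n.
rewrite Z2_natE modzNm; apply/eqP; rewrite eqz_mod_dvd opprK.
by apply: dvdz_trans h; rewrite dvdz_exp2l // -addn3 leq_addr.
Qed.

(** * Symmetric matrices over F_2 up to congruence *)

Lemma equivalence_partition_reps (T : finType) (R : rel T) (D : {set T}) :
    {in D & &, equivalence_rel R} ->
  exists rep : 'I_#|equivalence_partition R D| -> T,
    [/\ forall i, rep i \in D, forall i j, R (rep i) (rep j) -> i = j
      & forall x, x \in D -> exists i, R (rep i) x].
Proof.
move=> eqR; set P := equivalence_partition R D.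
have PP : partition P D by apply: equivalence_partitionP.
have pick (i : 'I_#|P|) : exists x, x \in (enum_val i : {set T}).
  apply/set0Pn; have := enum_valP i; apply: contraTneq => ->.
  by case/and3P: PP.
have /choice [rep repP] := pick.
have repD i : rep i \in D.
  by rewrite -(cover_partition PP); apply/bigcupP; exists (enum_val i); rewrite ?enum_valP.
have blk i : pblock P (rep i) = enum_val i.
  by apply: def_pblock => //; [case/and3P: PP | rewrite enum_valP].
exists rep; split => // [i j Rij|x xD].
  apply: enum_val_inj; rewrite -!blk; apply/esym/same_pblock; first by case/and3P: PP.
  by rewrite pblock_equivalence_partition.
have xP : pblock P x \in P by rewrite pblock_mem ?(cover_partition PP).
exists (enum_rank_in xP (pblock P x)).
rewrite -(pblock_equivalence_partition eqR) // -/P blk enum_rankK_in //.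
by rewrite mem_pblock (cover_partition PP).
Qed.

Lemma congruent_mx_refl r : reflexive (@congruent_mx r).
Proof.
by move=> A; apply/existsP; exists 1%:M; rewrite unitmx1 trmx1 mul1mx mulmx1 eqxx.
Qed.

Lemma congruent_mx_sym r : symmetric (@congruent_mx r).
Proof.
suff h (A B : 'M['F_2]_r) : congruent_mx A B -> congruent_mx B A by move=> A B; apply/idP/idP; apply: h.
move=> /existsP [P /andP [Pu /eqP ->]]; apply/existsP; exists (invmx P).
by rewrite unitmx_inv Pu trmx_inv !mulmxA mulVmx ?unitmx_tr // mul1mx mulmxK ?eqxx.
Qed.

Lemma congruent_mx_trans r : transitive (@congruent_mx r).
Proof.
move=> B A C /existsP [P /andP [Pu /eqP ->]] /existsP [Q /andP [Qu /eqP ->]].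
by apply/existsP; exists (P *m Q); rewrite unitmx_mul Pu Qu trmx_mul !mulmxA eqxx.
Qed.

Lemma congruent_mx_rank n (A B : 'M['F_2]_n) : congruent_mx A B -> \rank A = \rank B.
Proof.
case/existsP => P /andP [Pu /eqP ->].
rewrite mxrankMfree ?row_free_unit // -[RHS]mxrank_tr trmx_mul trmxK.
by rewrite mxrankMfree ?mxrank_tr ?row_free_unit.
Qed.

(** The case [r = 0], where [m_ 0] is set to 1, agrees with the general rule:
    the empty matrix is the only element of its class. *)
Lemma symGL_reps r : exists rep : 'I_(m_ r) -> 'M['F_2]_r,
  [/\ forall i, rep i \in symGL r, forall i j, congruent_mx (rep i) (rep j) -> i = j
    & forall A, A \in symGL r -> exists i, congruent_mx (rep i) A].
Proof.
case: r => [|r].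
  exists (fun _ => 1%:M); split=> [i|i j _|A _].
  - by rewrite inE trmx1 eqxx unitmx1.
  - by rewrite [i]ord1 [j]ord1.
  - by exists 0; rewrite [A]thinmx0 [1%:M]thinmx0 congruent_mx_refl.
apply: equivalence_partition_reps => A B C _ _ _; split; first exact: congruent_mx_refl.
move=> AB; apply/idP/idP; apply: congruent_mx_trans => //.
by rewrite congruent_mx_sym.
Qed.

(** The block [A] bordered by zeros, when [r <= n]. *)
Definition pad r n (A : 'M['F_2]_r) : 'M['F_2]_n :=
  (pid_mx r : 'M_(r, n))^T *m A *m pid_mx r.

Lemma pid_mx_trK r n : (r <= n)%N -> (pid_mx r : 'M['F_2]_(r, n)) *m (pid_mx r)^T = 1%:M.
Proof. by move=> rn; rewrite tr_pid_mx pid_mx_id // pid_mx_1. Qed.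

Lemma pad_rank r n (A : 'M['F_2]_r) : (r <= n)%N -> \rank (pad n A) = \rank A.
Proof.
move=> rn; apply/eqP; rewrite eqn_leq /pad; apply/andP; split.
  by rewrite (leq_trans (mxrankM_maxl _ _)) // (leq_trans (mxrankM_maxr _ _)).
have {1}-> : A = pid_mx r *m pad n A *m (pid_mx r)^T.
  by rewrite /pad !mulmxA pid_mx_trK // mul1mx -mulmxA pid_mx_trK // mulmx1.
by rewrite (leq_trans (mxrankM_maxl _ _)) // (leq_trans (mxrankM_maxr _ _)).
Qed.

(** The upper left [r x r] block of a congruence between padded matrices is
    a congruence between the blocks; it is invertible because [B] is. *)
Lemma pad_congruent r n (A B : 'M['F_2]_r) : (r <= n)%N -> B \in unitmx ->
  congruent_mx (pad n A) (pad n B) -> congruent_mx A B.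
Proof.
move=> rn Bu /existsP [P /andP [_ /eqP PE]].
pose E : 'M['F_2]_(r, n) := pid_mx r; pose Q := E *m P *m E^T.
have BE : B = Q^T *m A *m Q.
  have -> : B = E *m pad n B *m E^T.
    by rewrite /pad !mulmxA pid_mx_trK // mul1mx -mulmxA pid_mx_trK // mulmx1.
  by rewrite PE /pad /Q !trmx_mul trmxK !mulmxA.
apply/existsP; exists Q; rewrite BE eqxx andbT; move: Bu.
by rewrite BE unitmx_mul => /andP [].
Qed.

(** A congruence [Q] of the blocks extends by the identity on the last [n - r]
    coordinates. *)
Lemma congruent_pad r n (A B : 'M['F_2]_r) : (r <= n)%N ->
  congruent_mx A B -> congruent_mx (pad n A) (pad n B).
Proof.
move=> rn /existsP [Q /andP [Qu /eqP ->]].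
pose E : 'M['F_2]_(r, n) := pid_mx r.
have EE : E *m E^T = 1%:M by apply: pid_mx_trK.
pose ext (X : 'M_r) : 'M_n := E^T *m X *m E + (1%:M - E^T *m E).
have Eext X : E *m ext X = X *m E.
  by rewrite mulmxDr mulmxBr !mulmxA EE !mul1mx mulmx1 subrr addr0.
apply/existsP; exists (ext Q); apply/andP; split.
  have [] // := mulmx1_unit (_ : ext Q *m ext (invmx Q) = 1%:M).
  rewrite {1}/ext mulmxDl mulmxBl mul1mx -!mulmxA Eext !mulmxA.
  by rewrite -(mulmxA _ Q) mulmxV // mulmx1 /ext addrC [X in X - _]addrC addrK subrK.
rewrite /pad -/E; apply/eqP.
transitivity ((E *m ext Q)^T *m A *m (E *m ext Q)); last by rewrite trmx_mul !mulmxA.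
by rewrite Eext trmx_mul !mulmxA.
Qed.

(** The rows of [R] below form a basis of the row space of [B].  By symmetry
    the columns of [R^T] form a basis of its column space, so [B = R^T A R]
    with [A] of size [\rank B]; completing [R] to an invertible matrix gives
    the congruence. *)
Lemma sym_congruent_pad n (B : 'M['F_2]_n) : B^T = B ->
  exists r (A : 'M['F_2]_r), [/\ (r <= n)%N, A \in symGL r & congruent_mx (pad n A) B].
Proof.
move=> BT.
have [r [C [R [R' [U [BCR RR' RU Uu rB]]]]]] : exists r (C : 'M_(n, r)) R R' U,
    [/\ B = C *m R, R *m R' = 1%:M, R = pid_mx r *m U, U \in unitmx & r = \rank B].
  exists (\rank B), (B *m pinvmx (row_base B)), (row_base B), (pinvmx (row_base B)).
  exists (row_ebase B); rewrite row_ebase_unit mulmxKpV ?eq_row_base //.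
  by split => //; apply: mulmxVp; apply: row_base_free.
pose A : 'M_r := R'^T *m B *m R'.
have BRR : B *m R' *m R = B by rewrite {1}BCR -(mulmxA C) RR' mulmx1 -BCR.
have BA : B = R^T *m A *m R.
  have RRB : R^T *m R'^T *m B = B by rewrite -[B in LHS]BT -!trmx_mul mulmxA BRR.
  by rewrite /A !mulmxA RRB BRR.
exists r, A; split; first by rewrite rB rank_leq_row.
  rewrite inE; apply/andP; split; first by rewrite /A !trmx_mul trmxK BT mulmxA.
  rewrite -row_free_unit /row_free eqn_leq rank_leq_row /= {1}rB {1}BA.
  by rewrite (leq_trans (mxrankM_maxl _ _)) // (leq_trans (mxrankM_maxr _ _)).
apply/existsP; exists U; rewrite Uu /=.
by rewrite {1}BA /pad RU trmx_mul !mulmxA.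
Qed.

Lemma sym_reps n : exists rep : 'I_(\sum_(0 <= r < n.+1) m_ r)%N -> 'M['F_2]_n,
  [/\ forall i, (rep i)^T = rep i, forall i j, congruent_mx (rep i) (rep j) -> i = j
    & forall B, B^T = B -> exists i, congruent_mx (rep i) B].
Proof.
have reps (r : 'I_n.+1) := cid (symGL_reps r).
pose T := {r : 'I_n.+1 & 'I_(m_ r)}.
have -> : (\sum_(0 <= r < n.+1) m_ r)%N = #|{: T}|.
  rewrite card_tagged sumnE big_map big_enum big_mkord /=.
  by apply: eq_bigr => i _; rewrite card_ord.
pose A (t : T) : 'M['F_2]_(tag t) := sval (reps (tag t)) (tagged t).
have AS t : A t \in symGL (tag t) by rewrite /A; case: (reps _) => f [].
exists (fun i => pad n (A (enum_val i))); split=> [i|i j ij|B BT].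
- have := AS (enum_val i); rewrite inE => /andP [/eqP AT _].
  by rewrite /pad !trmx_mul trmxK AT mulmxA.
- apply: enum_val_inj; move: ij (AS (enum_val i)) (AS (enum_val j)).
  case: (enum_val i) (enum_val j) => [r a] [t b]; rewrite !inE.
  have [rn tn] : (r <= n /\ t <= n)%N by split; rewrite -ltnS.
  move=> ab /andP [_ Au] /andP [_ Bu].
  have rt : r = t.
    apply: val_inj => /=; rewrite -[LHS](mxrank_unit Au) -[RHS](mxrank_unit Bu).
    by rewrite -(pad_rank _ rn) -(pad_rank _ tn) (congruent_mx_rank ab).
  subst t.
  have := pad_congruent rn Bu ab; rewrite /A /=.
  by have [_ inj _] := svalP (reps r) => /inj ->.
- have [r [C [rn CS CB]]] := sym_congruent_pad BT.
  pose r' : 'I_n.+1 := Ordinal (rn : (r < n.+1)%N).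
  have [i iC] : exists i, congruent_mx (sval (reps r') i) C.
    by have [_ _ /(_ C CS)] := svalP (reps r').
  exists (enum_rank (Tagged (fun r : 'I_n.+1 => 'I_(m_ r)) i : T)); rewrite enum_rankK.
  apply: congruent_mx_trans CB; move: iC; rewrite /A /=.
  exact: congruent_pad.
Qed.

(** * Matrix pairs and symplectic frames *)

(** The Gram matrix [J] and the matrix [T] of [pi] in a basis of a self-dual
    skew-Hermitian module.  The form is alternating because [J] is
    antisymmetric and Z_2 has no 2-torsion ([gram_alt]). *)
Definition skew_pair p N (J T : 'M[Z2]_N) : Prop :=
  [/\ J^T = - J, T *m T = (- p%:R)%:M, T *m J = - (J *m T^T)
    & exists K, J *m K = 1%:M].

Lemma mx_double_eq0 m n (X : 'M[Z2]_(m, n)) : X + X = 0 -> X = 0.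
Proof.
by move=> /matrixP X2; apply/matrixP=> i j; have := X2 i j; rewrite !mxE => /Z2_double_eq0.
Qed.

Lemma red_mx_eq0 m n (X : 'M[Z2]_(m, n)) : map_mx red X = 0 -> exists Y, X = Y + Y.
Proof.
move=> /matrixP X0.
have /choice [F FP] ij : exists y, X ij.1 ij.2 = y + y.
  by apply: red_eq0; have := X0 ij.1 ij.2; rewrite !mxE.
by exists (\matrix_(i, j) F (i, j)); apply/matrixP => i j; rewrite !mxE -FP.
Qed.

(** Otherwise [X] would be divisible by every power of 2, hence zero. *)
Lemma mx_primitive m n (X : 'M[Z2]_(m, n)) : X != 0 ->
  exists Y k, X = 2%:R ^+ k *: Y /\ map_mx red Y != 0.
Proof.
move=> X0; suff [k kP] : exists k, forall Y, X <> 2%:R ^+ k *: Y.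
  elim: k kP => [|k IHk] kP; first by have := kP X; rewrite expr0 scale1r.
  have [/existsNP[Y /contrapT XY]|] := pselect (~ forall Y, X <> 2%:R ^+ k *: Y); last first.
    by move=> /contrapT /IHk.
  exists Y, k; split => //; apply/eqP => /red_mx_eq0 [Z ZY]; apply: (kP Z).
  by rewrite XY ZY -mulr2n -scaler_nat scalerA -exprSr.
apply: contrapT => h; move/eqP: X0; apply; apply/matrixP => i j; rewrite mxE.
apply: Z2_eqP => k /=; rewrite mod0z.
have /existsNP[Y /contrapT ->] := (forallNP _).2 h k; rewrite mxE /=.
have -> : (2%:R ^+ k : Z2) k = 0.
  by rewrite -natrX Z2_natE -[Posz (2 ^ k)]natz natrX /= modzz.
by rewrite mul0r mod0z.
Qed.

Section Frames.
Variables (p : nat) (s s' : Z2) (N : nat) (J T : 'M[Z2]_N).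
Hypotheses (ss : s * s = - p%:R) (ss' : s * s' = 1) (sp : skew_pair p J T).

Lemma scale_antieq0 m n (X : 'M[Z2]_(m, n)) : s *: X = - (s *: X) -> X = 0.
Proof.
move=> /eqP; rewrite -subr_eq0 opprK => /eqP /mx_double_eq0 sX.
by rewrite -[X]scale1r -ss' mulrC -scalerA sX scaler0.
Qed.

Lemma gramT m n (A : 'M_(m, N)) (B : 'M_(n, N)) : (A *m J *m B^T)^T = - (B *m J *m A^T).
Proof. by case: sp => JT _ _ _; rewrite !trmx_mul trmxK JT mulNmx mulmxN mulmxA. Qed.

Lemma gram_adj m n (A : 'M_(m, N)) (B : 'M_(n, N)) :
  A *m T *m J *m B^T = - (A *m J *m (B *m T)^T).
Proof. by case: sp => _ _ TJ _; rewrite -(mulmxA A) TJ mulmxN mulNmx trmx_mul !mulmxA. Qed.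

(** [s psi(x, y) = psi(pi x, y) = - psi(x, pi y) = - s psi(x, y)]. *)
Lemma eigen_isotropic m n (A : 'M_(m, N)) (B : 'M_(n, N)) :
  A *m T = s *: A -> B *m T = s *: B -> A *m J *m B^T = 0.
Proof.
move=> AT BT; apply: scale_antieq0.
by rewrite [LHS]scalemxAl [in LHS]scalemxAl -AT gram_adj BT linearZ -scalemxAr.
Qed.

(** A partial symplectic basis whose first half consists of [s]-eigenvectors,
    which are mutually orthogonal by [eigen_isotropic]. *)
Definition frame k (e f : 'M_(k, N)) : Prop :=
  [/\ e *m T = s *: e, f *m J *m f^T = 0 & e *m J *m f^T = 1%:M].

Lemma frame_gram_fe k (e f : 'M_(k, N)) : frame e f -> f *m J *m e^T = - 1%:M.
Proof. by case=> _ _ ef; rewrite -[LHS]opprK -gramT ef trmx1. Qed.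

Lemma gram_alt (x : 'rV_N) : x *m J *m x^T = 0.
Proof.
apply: mx_double_eq0; have := gramT x x.
rewrite [_^T](_ : _ = x *m J *m x^T) => [/eqP|]; first by rewrite -subr_eq0 opprK => /eqP.
by apply/matrixP => i j; rewrite !mxE !ord1.
Qed.

(** Project [v] away from [e] along [f] and divide by a power of 2: this gives
    a primitive eigenvector [w] orthogonal to the frame.  As [J] is
    invertible, some [g] pairs to 1 with [w], and it can be made orthogonal to
    the frame as well. *)
Lemma frame_extend k (e f : 'M_(k, N)) (v : 'rV_N) :
    frame e f -> v *m T = s *: v -> v != v *m J *m f^T *m e ->
  exists e' f' : 'M_(k + 1, N), frame e' f'.
Proof.
move=> ff vT v0; case: (ff) => eT fJf eJf; have fJe := frame_gram_fe ff.
have [w [m [wE w0]]] : exists w m,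
    v - v *m J *m f^T *m e = 2%:R ^+ m *: w /\ map_mx red w != 0.
  by apply: mx_primitive; rewrite subr_eq0.
have tf q (X : 'rV[Z2]_q) : 2%:R ^+ m *: X = 0 -> X = 0.
  elim: m {wE} => [|m IHm]; first by rewrite expr0 scale1r.
  rewrite exprS -scalerA => h; apply: IHm; apply: mx_double_eq0.
  by rewrite -mulr2n -scaler_nat.
have wT : w *m T = s *: w.
  apply/eqP; rewrite -subr_eq0; apply/eqP/tf; apply/eqP.
  rewrite scalerBr subr_eq0 scalemxAl scalerA mulrC -scalerA -wE.
  by rewrite mulmxBl vT -(mulmxA _ e) eT -scalemxAr scalerBr.
have wJf : w *m J *m f^T = 0.
  apply: tf; rewrite 2!scalemxAl -wE !mulmxBl.
  by rewrite -[X in _ - X]mulmxA -[X in _ - X]mulmxA [e *m (J *m _)]mulmxA eJf mulmx1 subrr.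
have [g wg] : exists g : 'rV_N, w *m J *m g^T = 1%:M.
  have [K JK] : exists K, J *m K = 1%:M by case: sp.
  have [i wi] : exists i, red ((w *m J) 0 i) != 0.
    apply: contrapT => h; move/eqP: w0; apply.
    have -> : w = w *m J *m K by rewrite -mulmxA JK mulmx1.
    rewrite map_mxM (_ : map_mx red (w *m J) = 0) ?mul0mx //.
    apply/matrixP => i j; rewrite mxE [i]ord1 [RHS]mxE; apply/eqP/negPn/negP => hj.
    by apply: h; exists j.
  have [y hy] := Z2_inv wi.
  exists (y *: delta_mx 0 i); apply/matrixP => a b; rewrite [a]ord1 [b]ord1 linearZ /=.
  by rewrite trmx_delta -scalemxAr -colE !mxE -hy mulrC mxE.
(* Only a combination of [e] and [f] is added, and [w] is orthogonal to it. *)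
pose g' := g - g *m J *m f^T *m e + g *m J *m e^T *m f.
have eJe : e *m J *m e^T = 0 by apply: eigen_isotropic.
have wJe : w *m J *m e^T = 0 by apply: eigen_isotropic.
have g'Jf : g' *m J *m f^T = 0.
  rewrite !mulmxDl !mulNmx -[X in _ - X]mulmxA -[X in _ - X]mulmxA [e *m (J *m _)]mulmxA eJf.
  by rewrite mulmx1 subrr -2![X in _ + X]mulmxA [f *m (J *m _)]mulmxA fJf mulmx0 addr0.
have g'Je : g' *m J *m e^T = 0.
  rewrite !mulmxDl !mulNmx -[X in _ - X]mulmxA -[X in _ - X]mulmxA [e *m (J *m _)]mulmxA eJe.
  rewrite mulmx0 subr0 -2![X in _ + X]mulmxA [f *m (J *m _)]mulmxA fJe.
  by rewrite mulmxN mulmx1 subrr.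
have wg' : w *m J *m g'^T = 1%:M.
  have -> : g'^T = g^T - e^T *m (g *m J *m f^T)^T + f^T *m (g *m J *m e^T)^T.
    by rewrite -!trmx_mul -linearB -linearD.
  by rewrite mulmxDr mulmxBr wg !mulmxA wJe wJf !mul0mx subr0 addr0.
have fJg' : f *m J *m g'^T = 0 by rewrite -[LHS]opprK -gramT g'Jf trmx0 oppr0.
have eJg' : e *m J *m g'^T = 0 by rewrite -[LHS]opprK -gramT g'Je trmx0 oppr0.
exists (col_mx e w), (col_mx f g'); split.
- by rewrite mul_col_mx eT wT scale_col_mx.
- rewrite mul_col_mx tr_col_mx mul_col_row fJf fJg' g'Jf gram_alt.
  by rewrite block_mx0.
- by rewrite mul_col_mx tr_col_mx mul_col_row eJf wJf wg' eJg' -scalar_mx_block.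
Qed.

(** A frame of maximal size spans the whole [s]-eigenspace: the sizes are
    bounded by [N] because [e *m J *m f^T] is an identity matrix. *)
Lemma frame_saturated : exists k (e f : 'M_(k, N)), frame e f /\
  forall v : 'rV_N, v *m T = s *: v -> v = v *m J *m f^T *m e.
Proof.
suff H m : forall k (e f : 'M_(k, N)), frame e f -> (N <= k + m)%N ->
    exists k (e f : 'M_(k, N)), frame e f /\
    forall v : 'rV_N, v *m T = s *: v -> v = v *m J *m f^T *m e.
  apply: (H N 0%N 0 0) => //; split; first by rewrite mul0mx scaler0.
    by rewrite !mul0mx.
  by apply/matrixP => [[]].
elim: m => [|m IHm] k e f ff Nk.
  exists k, e, f; split => // v vT; apply/eqP/negPn/negP => h.
  have [e' [f' [_ _ /mulmx1_min]]] := frame_extend ff vT h.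
  lia.
have [h|] := pselect (forall v : 'rV_N, v *m T = s *: v -> v = v *m J *m f^T *m e).
  by exists k, e, f.
move=> /existsNP [v /not_implyP [vT /eqP h]].
have [e' [f' ff']] := frame_extend ff vT h.
by apply: IHm ff' _; lia.
Qed.

(** Let [W] be the projection onto the orthogonal of the frame.  The vectors
    [(pi + s) x], for [x] in that orthogonal, are [s]-eigenvectors, hence
    combinations of [e], hence orthogonal to the image of [W].  So [pi] acts
    as [- s] for the form restricted to this image, which is therefore
    isotropic, as in [eigen_isotropic]; the form being nondegenerate,
    [W = 0] and the frame spans everything. *)
Lemma frame_basis k (e f : 'M_(k, N)) : frame e f ->
    (forall v : 'rV_N, v *m T = s *: v -> v = v *m J *m f^T *m e) ->
  row_mx (J *m f^T) (- (J *m e^T)) *m col_mx e f = 1%:M.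
Proof.
move=> ff sat; case: (ff) => eT fJf eJf; have fJe := frame_gram_fe ff.
have eJe : e *m J *m e^T = 0 by apply: eigen_isotropic.
have [JT TT TJ [K JK]] := sp.
pose W : 'M_N := 1%:M - J *m f^T *m e + J *m e^T *m f.
have WJf : W *m J *m f^T = 0.
  rewrite !mulmxDl !mulNmx mul1mx -[X in _ - X]mulmxA -[X in _ - X]mulmxA [e *m (J *m _)]mulmxA eJf.
  by rewrite mulmx1 subrr -2![X in _ + X]mulmxA [f *m (J *m _)]mulmxA fJf mulmx0 addr0.
have WJe : W *m J *m e^T = 0.
  rewrite !mulmxDl !mulNmx mul1mx -[X in _ - X]mulmxA -[X in _ - X]mulmxA [e *m (J *m _)]mulmxA eJe.
  rewrite mulmx0 subr0 -2![X in _ + X]mulmxA [f *m (J *m _)]mulmxA fJe.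
  by rewrite mulmxN mulmx1 subrr.
have eJW : e *m J *m W^T = 0 by rewrite -[LHS]opprK -gramT WJe trmx0 oppr0.
pose Y := W *m T + s *: W.
have YT : Y *m T = s *: Y.
  rewrite {1}/Y mulmxDl -(mulmxA W) TT -[X in _ + X]scalemxAl /Y scalerDr scalerA ss addrC; congr (_ + _).
  by rewrite mul_mx_scalar.
have YE : Y = Y *m J *m f^T *m e.
  apply/row_matrixP => i; rewrite !row_mul; apply: sat.
  by rewrite -row_mul YT linearZ.
have YJW : Y *m J *m W^T = 0.
  by rewrite YE -2![LHS]mulmxA [e *m _]mulmxA eJW mulmx0.
have WJW : W *m J *m W^T = 0.
  apply: scale_antieq0; set X := W *m J *m W^T.
  have TX : W *m T *m J *m W^T = - (s *: X).
    apply/eqP; rewrite -subr_eq0 opprK /X -YJW /Y mulmxDl mulmxDl.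
    by rewrite -!scalemxAl.
  have XT : X^T = - X by rewrite gramT.
  have TX2 : (W *m T *m J *m W^T)^T = - (s *: X).
    by rewrite (gram_adj W W) raddfN /= gramT opprK TX.
  by rewrite -[RHS]TX2 TX raddfN /= linearZ /= XT scalerN opprK.
have WJ : W *m J = 0.
  have W1 : 1%:M = W^T + (J *m f^T *m e)^T - (J *m e^T *m f)^T.
    rewrite -[LHS]trmx1 -linearD -linearB /=; congr (_^T).
    by rewrite /W addrAC addrK subrK.
  rewrite -[W *m J]mulmx1 W1 mulmxBr mulmxDr WJW add0r !trmx_mul !trmxK !mulmxA.
  by rewrite WJe WJf !mul0mx subr0.
have W0 : W = 0 by rewrite -[W]mulmx1 -JK mulmxA WJ mul0mx.
rewrite mul_row_col mulNmx; apply/eqP; rewrite eq_sym -subr_eq0 opprB -W0 /W.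
by rewrite addrCA addrC.
Qed.

End Frames.

(** * Standard pairs and their isometries *)

Definition stdJ n : 'M[Z2]_(n + n) := block_mx 0 1%:M (- 1%:M) 0.
Definition stdT (s : Z2) n (B : 'M_n) : 'M[Z2]_(n + n) :=
  block_mx s%:M 0 B (- s)%:M.

Lemma stdJ_inv n : stdJ n *m (- stdJ n) = 1%:M.
Proof.
rewrite mulmxN /stdJ mulmx_block !(mul0mx, mulmx0, mul1mx, mulmx1, addr0, add0r).
by rewrite opp_block_mx !opprK !oppr0 -scalar_mx_block.
Qed.

Lemma stdJ_tr n : (stdJ n)^T = - stdJ n.
Proof.
by rewrite /stdJ tr_block_mx opp_block_mx !linear0 linearN /= trmx1 opprK.
Qed.

Lemma std_skew_pair p s n (B : 'M_n) : s * s = - p%:R -> B^T = B ->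
  skew_pair p (stdJ n) (stdT s B).
Proof.
move=> ss BT; split; first exact: stdJ_tr.
- rewrite /stdT mulmx_block -!scalar_mxM !(mul0mx, mulmx0, addr0, add0r).
  rewrite mulrNN ss mul_mx_scalar mul_scalar_mx scaleNr subrr.
  by rewrite -scalar_mx_block.
- rewrite /stdT /stdJ tr_block_mx !mulmx_block !linear0 BT !tr_scalar_mx.
  rewrite !(mul0mx, mulmx0, mul1mx, mulmx1, addr0, add0r) opp_block_mx !mulNmx !mulmxN.
  by rewrite !(mul1mx, mulmx1) !raddfN /= !opprK oppr0.
- by exists (- stdJ n); apply: stdJ_inv.
Qed.

Definition mx_isometry N (J1 T1 : 'M[Z2]_N) N' (J2 T2 : 'M[Z2]_N') (G : 'M[Z2]_(N, N')) : Prop :=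
  T1 *m G = G *m T2 /\ G *m J2 *m G^T = J1.

(** The frame has size exactly [n]: it is linearly independent, its Gram
    matrix being invertible, and it spans.  The matrix [B] is made of the
    pairings of [pi f] with [f]. *)
Lemma normal_form p s s' n (J T : 'M[Z2]_(n + n)) :
  s * s = - p%:R -> s * s' = 1 -> skew_pair p J T ->
  exists (B : 'M[Z2]_n) G, B^T = B /\ mx_isometry (stdJ n) (stdT s B) J T G.
Proof.
move=> ss ss' sp.
have [k [e [f [ff sat]]]] := frame_saturated ss' sp.
have DQ := frame_basis ss ss' sp ff sat.
have [eT fJf eJf] := ff.
have eJe : e *m J *m e^T = 0 by apply: (eigen_isotropic ss' sp).
have fJe := frame_gram_fe sp ff.
have QJQ : col_mx e f *m J *m (col_mx e f)^T = stdJ k.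
  by rewrite mul_col_mx tr_col_mx mul_col_row eJe eJf fJe fJf.
have kn : k = n.
  have := mulmx1_min DQ.
  have := stdJ_inv k; rewrite -{1}QJQ -2!mulmxA => /mulmx1_min.
  lia.
move: e f ff sat DQ eT fJf eJf eJe fJe QJQ; rewrite kn => e f ff sat DQ eT fJf eJf eJe fJe QJQ.
pose B := f *m T *m J *m f^T.
exists B, (col_mx e f); split => //.
  by rewrite /B [in LHS](gram_adj sp) linearN /= (gramT sp) opprK.
split; last exact: QJQ.
rewrite /stdT mul_block_col mul_col_mx !mul0mx addr0 eT !mul_scalar_mx; congr col_mx.
rewrite -[RHS]mulmx1 -DQ mulmxA mul_mx_row mul_row_col mulmxN !mulmxA.
rewrite [f *m T *m J *m e^T](gram_adj sp) eT linearZ /= -scalemxAr fJe.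
by rewrite opprK scalerN mulNmx -scalemxAl mul1mx scaleNr.
Qed.

Lemma red_lift (a : 'F_2) : red ((a : nat)%:R) = a.
Proof. by rewrite rmorph_nat; apply/val_inj; case: a => [[|[|]]]. Qed.

Lemma F2_mulr2n m n (X : 'M['F_2]_(m, n)) : X *+ 2 = 0.
Proof. by apply/matrixP => i j; rewrite mulmxnE mxE -mulr_natr (_ : 2%:R = 0) ?mulr0 //; apply/val_inj. Qed.

(** Writing the isometry as [a b c d] in blocks, commutation with [pi] forces
    [2 s b = 0] and [B1 a = d B2 + 2 s c], while compatibility with the forms
    gives [a d^T = 1]; hence [B1 = d B2 d^T + 2 s c d^T]. *)
Lemma std_isometry_congruent s s' n (B1 B2 : 'M[Z2]_n) G :
  s * s' = 1 -> mx_isometry (stdJ n) (stdT s B1) (stdJ n) (stdT s B2) G ->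
  congruent_mx (map_mx red B2) (map_mx red B1).
Proof.
move=> ss' []; rewrite -[G]submxK /stdT /stdJ.
set a := ulsubmx G; set b := ursubmx G; set c := dlsubmx G; set d := drsubmx G.
rewrite !mulmx_block tr_block_mx !mulmx_block.
rewrite !(mul0mx, mulmx0, mul1mx, mulmx1, addr0, add0r, mulmxN, mulNmx).
move=> /eq_block_mx [_ bE cE _] /eq_block_mx [_ adE _ _].
have b0 : b = 0.
  apply: (scale_antieq0 ss'); move: bE.
  by rewrite mul_scalar_mx mul_mx_scalar scaleNr.
have ad : a *m d^T = 1%:M by rewrite -adE b0 mul0mx oppr0 add0r.
have BE : B1 = d *m B2 *m d^T + s *: (c *m d^T) + s *: (c *m d^T).
  rewrite -[LHS]mulmx1 -ad mulmxA (_ : B1 *m a = c *m s%:M + d *m B2 + s *: c).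
    by rewrite mul_mx_scalar !mulmxDl -!scalemxAl [X in X + _]addrC.
  by rewrite -cE mul_scalar_mx scaleNr subrK.
apply/existsP; exists (map_mx red d)^T; apply/andP; split.
  have [] := mulmx1_unit (_ : map_mx red a *m (map_mx red d)^T = 1%:M) => //.
  by rewrite map_trmx -map_mxM ad map_mx1.
rewrite trmxK map_trmx -!map_mxM {1}BE -addrA raddfD /=.
by rewrite -mulr2n raddfMn /= F2_mulr2n addr0.
Qed.

Lemma red_unit_inv n (d : 'M[Z2]_n) : map_mx red d \in unitmx -> exists a, a *m d^T = 1%:M.
Proof.
rewrite unitmxE det_map_mx unitfE => /Z2_inv [y hy].
exists (y *: (\adj d)^T); rewrite -scalemxAl -trmx_mul mul_mx_adj tr_scalar_mx.
by rewrite scale_scalar_mx mulrC hy.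
Qed.

(** Lift the congruence modulo 2 to an invertible matrix [d]; then
    [B1 - d B2 d^T = 2 S] with [S] symmetric, and the entry [c] below is the
    solution of [s c d^T = S] found in the previous proof. *)
Lemma congruent_std_isometry s s' n (B1 B2 : 'M[Z2]_n) :
  s * s' = 1 -> B1^T = B1 -> B2^T = B2 ->
  congruent_mx (map_mx red B2) (map_mx red B1) ->
  exists G, mx_isometry (stdJ n) (stdT s B1) (stdJ n) (stdT s B2) G.
Proof.
move=> ss' B1T B2T /existsP [P /andP [Pu /eqP PE]].
pose d : 'M[Z2]_n := map_mx (fun x : 'F_2 => (x : nat)%:R) P^T.
have dE : map_mx red d = P^T by apply/matrixP => i j; rewrite !mxE red_lift.
have [a ad] : exists a, a *m d^T = 1%:M by apply: red_unit_inv; rewrite dE unitmx_tr.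
have [S SE] : exists S, B1 - d *m B2 *m d^T = S + S.
  apply: red_mx_eq0; rewrite map_mxB !map_mxM -map_trmx dE trmxK PE subrr //.
have ST : S^T = S.
  apply/eqP; rewrite -subr_eq0; apply/eqP/mx_double_eq0.
  rewrite addrACA -opprD -SE -linearD /= -SE.
  by rewrite linearB /= !trmx_mul trmxK B1T B2T mulmxA subrr.
pose c := s' *: (S *m a).
have da : d *m a^T = 1%:M by rewrite -[LHS]trmxK trmx_mul trmxK ad trmx1.
have sc : s *: c = S *m a by rewrite /c scalerA ss' scale1r.
exists (block_mx a 0 c d); split; rewrite /stdT /stdJ ?tr_block_mx !mulmx_block.
  rewrite !(mul0mx, mulmx0, addr0, add0r) !mul_scalar_mx !mul_mx_scalar.
  congr block_mx; rewrite scaleNr sc; apply/eqP; rewrite subr_eq addrAC -mulmxDl -SE.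
  by rewrite mulmxBl -!mulmxA (mulmx1C ad) mulmx1 subrK.
rewrite trmx0 !(mul0mx, mulmx0, mul1mx, mulmx1, addr0, add0r, mulmxN, mulNmx, oppr0) ad da.
congr block_mx; rewrite /c linearZ /= -scalemxAr -scalemxAl trmx_mul ST -mulmxA ad mulmx1.
by rewrite mulmxA da mul1mx addNr.
Qed.

Lemma isometry_unit p N (J1 T1 J2 T2 G : 'M[Z2]_N) :
  skew_pair p J1 T1 -> mx_isometry J1 T1 J2 T2 G ->
  exists H, H *m G = 1%:M /\ G *m H = 1%:M.
Proof.
case=> _ _ _ [K JK] [_ GJG]; rewrite -GJG -!mulmxA in JK.
by eexists; split; last exact: JK; apply: mulmx1C.
Qed.

(** * Coordinates on the order R *)

Section Coordinates.
Variable p : nat.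
Implicit Types a b : Rp p.

(** The coordinates of [a] in the basis [(1, pi)] of [R] over Z_2. *)
Definition re a : Z2 := (a : {poly Z2})`_0.
Definition im a : Z2 := (a : {poly Z2})`_1.

Lemma size_X2p : size (X2p p) = 3.
Proof.
rewrite /X2p size_polyDl size_polyXn //.
by rewrite (leq_ltn_trans (size_polyC_leq1 _)).
Qed.

Lemma X2p_monic : X2p p \is monic.
Proof. by rewrite -mk_monic_X2p; apply: monic_mk_monic. Qed.

Lemma Rp_polyE a : (a : {poly Z2}) = (re a)%:P + (im a)%:P * 'X.
Proof.
have sa : (size (a : {poly Z2}) <= 2)%N.
  by rewrite -ltnS (leq_trans (size_mk_monic a)) // mk_monic_X2p size_X2p.
apply/polyP => i; rewrite coefD coefC coefCM coefX.
case: i => [|[|i]] /=; rewrite ?mulr0 ?addr0 ?mulr1 ?add0r //.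
by rewrite nth_default // (leq_trans sa).
Qed.

Lemma Rp_eqP a b : re a = re b -> im a = im b -> a = b.
Proof. by move=> e1 e2; apply: val_inj; rewrite /= Rp_polyE e1 e2 -Rp_polyE. Qed.

Lemma size_linpoly (x y : Z2) : (size (x%:P + y%:P * 'X)%R <= 2)%N.
Proof.
apply/leq_sizeP => i; rewrite coefD coefC coefCM coefX.
by case: i => [|[|i]] // _; rewrite mulr0 addr0.
Qed.

Lemma coef_linpoly (x y : Z2) :
  (x%:P + y%:P * 'X)`_0 = x /\ (x%:P + y%:P * 'X)`_1 = y.
Proof. by rewrite !coefD !coefC !coefCM !coefX /= mulr0 mulr1 addr0 add0r. Qed.

Lemma re_im_mul a b :
  re (a * b) = re a * re b - p%:R * (im a * im b) /\
  im (a * b) = re a * im b + im a * re b.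
Proof.
have E : ((a * b : Rp p) : {poly Z2}) = (re a * re b - p%:R * (im a * im b))%:P
    + (re a * im b + im a * re b)%:P * 'X.
  rewrite poly_of_qpolyM (Rp_polyE a) (Rp_polyE b) mk_monic_X2p.
  rewrite (_ : ((re a)%:P + (im a)%:P * 'X) * ((re b)%:P + (im b)%:P * 'X) = (im a * im b)%:P * X2p p + ((re a * re b - p%:R * (im a * im b))%:P
    + (re a * im b + im a * re b)%:P * 'X)).
    by rewrite Pdiv.RingMonic.rmodp_addl_mul_small ?X2p_monic // size_X2p ltnS size_linpoly.
  rewrite /X2p !(polyCD, polyCN, polyCM, polyCB); ring.
by rewrite /re /im E; apply: coef_linpoly.
Qed.

Lemma re_im_add a b : re (a + b) = re a + re b /\ im (a + b) = im a + im b.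
Proof. by rewrite /re /im !coefD. Qed.

Lemma re_im_alg (c : Z2) : re (c%:A) = c /\ im (c%:A) = 0.
Proof. by rewrite /re /im /= !coefZ !coefC /= mulr1 mulr0. Qed.

Definition Rpi : Rp p := 'qX.

Lemma re_im_pi : re Rpi = 0 /\ im Rpi = 1.
Proof. by rewrite /re /im /Rpi qpolyXE ?size_X2p ?X2p_monic // !coefX. Qed.

Lemma Rp_decomp a : a = (re a)%:A + (im a)%:A * Rpi.
Proof.
have [h1 h2] := re_im_pi.
apply: Rp_eqP.
  rewrite (re_im_add _ _).1 (re_im_mul _ _).1 !(re_im_alg _).1 !(re_im_alg _).2 h1 h2.
  ring.
rewrite (re_im_add _ _).2 (re_im_mul _ _).2 !(re_im_alg _).1 !(re_im_alg _).2 h1 h2.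
ring.
Qed.

Lemma re_im_conj a : re (Rconj a) = re a /\ im (Rconj a) = - im a.
Proof.
have E : (Rconj a : {poly Z2}) = (re a)%:P + (- im a)%:P * 'X.
  rewrite /Rconj (Rp_polyE a) comp_polyD comp_polyC comp_polyM comp_polyC comp_polyX.
  rewrite mulrN -mulNr -polyCN; apply: in_qpoly_small.
  by rewrite mk_monic_X2p size_X2p ltnS size_linpoly.
by rewrite /re /im E; apply: coef_linpoly.
Qed.

Lemma Rpi_sq : Rpi * Rpi = (- p%:R)%:A.
Proof.
have [h1 h2] := re_im_pi.
apply: Rp_eqP.
  rewrite (re_im_mul _ _).1 (re_im_alg _).1 h1 h2; ring.
rewrite (re_im_mul _ _).2 (re_im_alg _).2 h1 h2; ring.
Qed.

Lemma Rconj_pi : Rconj Rpi = - Rpi.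
Proof.
have [h1 h2] := re_im_pi.
apply: Rp_eqP; [rewrite (re_im_conj _).1 | rewrite (re_im_conj _).2];
  by rewrite /re /im !coefN -?[_`_0]/(re _) -?[_`_1]/(im _) ?h1 ?h2 ?oppr0.
Qed.

End Coordinates.

(** * Skew-Hermitian modules defined by matrix pairs *)

Lemma sh_iso_intro p (M N : skewHermMod p) (f : M -> N) : linear f -> bijective f ->
  (forall x y, shform N (f x) (f y) = shform M x y) -> sh_iso M N.
Proof.
move=> lf bf ff.
pose F : {linear M -> N} := HB.pack f (GRing.isLinear.Build _ _ _ _ f lf).
by exists F.
Qed.

Lemma Rp_linear p (M N : lmodType (Rp p)) (f : M -> N) :
    {morph f : x y / x + y} -> (forall (c : Z2) x, f (c%:A *: x) = c%:A *: f x) ->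
    (forall x, f (Rpi p *: x) = Rpi p *: f x) -> linear f.
Proof.
move=> fD fc fpi a x y.
rewrite fD [in LHS](Rp_decomp a) [in LHS]scalerDl fD -[in LHS]scalerA !fc fpi.
by rewrite [in RHS](Rp_decomp a) scalerDl -[in RHS]scalerA.
Qed.

Lemma sh_iso_trans p (L M N : skewHermMod p) : sh_iso L M -> sh_iso M N -> sh_iso L N.
Proof.
move=> [f [bf ff]] [g [bg gg]]; exists (g \o f)%FUN; split; first exact: bij_comp.
by move=> x y; rewrite /= gg ff.
Qed.

(** The proof [sp] is a parameter of the type because it makes the action of
    [R] on row vectors a module structure. *)
Definition mxmod p N (J T : 'M[Z2]_N) (sp : skew_pair p J T) : Type := 'rV[Z2]_N.

Section MatrixModule.
Variables (p N : nat) (J T : 'M[Z2]_N) (sp : skew_pair p J T).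
Local Notation V := (mxmod sp).

HB.instance Definition _ := GRing.Zmodule.on V.

Definition mxmod_scale (a : Rp p) (x : V) : V :=
  re a *: (x : 'rV[Z2]_N) + im a *: ((x : 'rV_N) *m T).

Fact mxmod_scaleA a b x : mxmod_scale a (mxmod_scale b x) = mxmod_scale (a * b) x.
Proof.
rewrite /mxmod_scale (re_im_mul a b).1 (re_im_mul a b).2.
have [_ TT _ _] := sp.
rewrite mulmxDl -!scalemxAl -mulmxA TT mul_mx_scalar.
apply/matrixP => i j; rewrite !mxE; set u := x i j; set w := (\sum_k _); ring.
Qed.

Fact mxmod_scale1 : left_id 1 mxmod_scale.
Proof.
move=> x; rewrite /mxmod_scale -[1]scale1r (re_im_alg p 1).1 (re_im_alg p 1).2.
by rewrite scale1r scale0r addr0.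
Qed.

Fact mxmod_scaleDr : right_distributive mxmod_scale +%R.
Proof. by move=> a x y; rewrite /mxmod_scale mulmxDl !scalerDr addrACA. Qed.

Fact mxmod_scaleDl x : {morph mxmod_scale^~ x : a b / a + b}.
Proof.
by move=> a b; rewrite /mxmod_scale (re_im_add a b).1 (re_im_add a b).2 !scalerDl addrACA.
Qed.

HB.instance Definition _ := GRing.Zmodule_isLmodule.Build (Rp p) V
  mxmod_scaleA mxmod_scale1 mxmod_scaleDr mxmod_scaleDl.

Lemma mxmod_scaleE (a : Rp p) (x : V) :
  a *: x = re a *: (x : 'rV_N) + im a *: ((x : 'rV_N) *m T).
Proof. by []. Qed.

Lemma mxmod_scaleC (c : Z2) (x : V) : c%:A *: x = c *: (x : 'rV_N).
Proof.
by rewrite mxmod_scaleE (re_im_alg p c).1 (re_im_alg p c).2 scale0r addr0.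
Qed.

Lemma mxmod_restr_scale (c : Z2) (x : restr V) : c *: x = c *: (x : 'rV_N).
Proof. exact: mxmod_scaleC. Qed.

Lemma mxmod_scale_pi (x : V) : Rpi p *: x = (x : 'rV_N) *m T.
Proof.
by rewrite mxmod_scaleE (re_im_pi p).1 (re_im_pi p).2 scale1r scale0r add0r.
Qed.

Definition mxform (x y : restr V) : Z2 := ((x : 'rV_N) *m J *m (y : 'rV_N)^T) 0 0.

Fact mxform_bilinear : bilinear_for *%R *%R mxform.
Proof.
split=> [u c x y|u c x y]; rewrite /mxform mxmod_restr_scale.
  by rewrite !mulmxDl -!scalemxAl !mxE.
by rewrite linearD linearZ /= mulmxDr -scalemxAr !mxE.
Qed.

HB.instance Definition _ := bilinear_isBilinear.Build Z2 (restr V) (restr V) Z2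
  *%R *%R mxform mxform_bilinear.

Lemma mxmod_free : free_of_rank (restr V) N.
Proof.
exists (fun i => delta_mx 0 i) => x; exists [ffun i => (x : 'rV_N) 0 i]; split.
  rewrite [LHS](@row_sum_delta _ N x); apply: eq_bigr => i _.
  by rewrite ffunE mxmod_restr_scale.
move=> c ->; apply/ffunP => i; rewrite ffunE.
rewrite (eq_bigr (fun i => c i *: (delta_mx 0 i : 'rV_N))) => [|j _]; last exact: mxmod_restr_scale.
rewrite (_ : \sum_(i < N) _ = \row_j c j); first by rewrite mxE.
by rewrite [RHS]row_sum_delta; apply: eq_bigr => j _; rewrite mxE.
Qed.

Lemma mxmod_fg : finitely_generated V.
Proof.
have [e eP] := mxmod_free; exists N, e => x.
have [c [xE _]] := eP x; exists (fun i => (c i)%:A); rewrite [LHS]xE.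
by apply: eq_bigr => i _.
Qed.

Lemma mxform_alt (x : V) : mxform x x = 0.
Proof. by rewrite /mxform (gram_alt sp) mxE. Qed.

Lemma mxform_nondeg (x : V) : (forall y, mxform x y = 0) -> x = 0.
Proof.
have [_ _ _ [K JK]] := sp => x0.
have xJ : (x : 'rV_N) *m J = 0.
  apply/matrixP => i j; have := x0 (delta_mx 0 j).
  by rewrite /mxform trmx_delta -colE !mxE [i]ord1.
by rewrite -[x](@mulmx1 _ 1 N) -JK mulmxA xJ mul0mx.
Qed.

Lemma mxform_adj (a : Rp p) (x y : V) : mxform (a *: x) y = mxform x (Rconj a *: y).
Proof.
rewrite /mxform !mxmod_scaleE.
rewrite (re_im_conj a).1 (re_im_conj a).2 linearD !linearZ /=.
rewrite !mulmxDl mulmxDr -!scalemxAl -!scalemxAr.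
by rewrite (gram_adj sp) scalerN scaleNr.
Qed.

Definition mxSkewHerm : skewHermMod p :=
  @SkewHermMod p V mxform mxmod_fg (ex_intro _ N mxmod_free)
    mxform_alt mxform_nondeg mxform_adj.

Lemma mxSkewHermE (x y : V) :
  shform mxSkewHerm x y = ((x : 'rV_N) *m J *m (y : 'rV_N)^T) 0 0.
Proof. by []. Qed.

(** A functional is the pairing with a row vector [r], and it is
    represented by [r *m J^-1]. *)
Lemma mxSkewHerm_self_dual : self_dual mxSkewHerm.
Proof.
move=> phi; have [_ _ _ [K JK]] := sp.
pose r : 'rV_N := \row_j phi (delta_mx 0 j : 'rV_N).
have KJ := mulmx1C JK.
exists (r *m K); split.
  move=> y; rewrite mxSkewHermE -(mulmxA r) KJ mulmx1.
  rewrite {2}[y](@row_sum_delta _ N) mxE.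
  rewrite (eq_bigr (fun i => ((y : 'rV_N) 0 i *: (delta_mx 0 i : restr V)))); last first.
    by move=> i _; rewrite mxmod_restr_scale.
  rewrite linear_sum; apply: eq_bigr => i _; rewrite linearZ /= !mxE.
  by rewrite mulrC.
move=> x xE.
rewrite -[RHS](@mulmx1 _ 1 N x) -JK mulmxA; congr (_ *m K).
apply/matrixP => i j; rewrite [i]ord1 [LHS]mxE -xE mxSkewHermE trmx_delta -colE.
by rewrite [LHS]mxE.
Qed.

End MatrixModule.

Lemma mx_isometry_sh_iso p N (J1 T1 J2 T2 : 'M[Z2]_N) (sp1 : skew_pair p J1 T1)
    (sp2 : skew_pair p J2 T2) G :
  mx_isometry J1 T1 J2 T2 G -> sh_iso (mxSkewHerm sp1) (mxSkewHerm sp2).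
Proof.
move=> iG; have [H [HG GH]] := isometry_unit sp1 iG; case: iG => TG GJ.
pose f (x : mxmod sp1) : mxmod sp2 := (x : 'rV_N) *m G.
apply: (@sh_iso_intro _ (mxSkewHerm sp1) (mxSkewHerm sp2) f).
- apply: Rp_linear => [x y|c x|x].
  + exact: mulmxDl.
  + by rewrite !mxmod_scaleC /f -scalemxAl.
  + by rewrite !mxmod_scale_pi /f -!mulmxA TG.
- exists (fun y => (y : 'rV_N) *m H) => x; rewrite /f.
    by rewrite -mulmxA GH mulmx1.
  by rewrite -mulmxA HG mulmx1.
- move=> x y; rewrite !mxSkewHermE /f trmx_mul -GJ.
  by rewrite !mulmxA.
Qed.

(** The matrix of an isomorphism has for rows the images of the unit vectors. *)
Lemma sh_iso_mx_isometry p N (J1 T1 J2 T2 : 'M[Z2]_N) (sp1 : skew_pair p J1 T1)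
    (sp2 : skew_pair p J2 T2) :
  sh_iso (mxSkewHerm sp1) (mxSkewHerm sp2) -> exists G, mx_isometry J1 T1 J2 T2 G.
Proof.
case=> f [_ fform].
pose G : 'M_N := \matrix_(i, j) ((f (delta_mx 0 i : 'rV_N) : 'rV_N) 0 j).
have fE (x : 'rV_N) : f x = x *m G.
  rewrite {1}[x]row_sum_delta.
  rewrite (eq_bigr (fun i => ((x 0 i)%:A *: (delta_mx 0 i : mxmod sp1)))); last first.
    by move=> i _; rewrite mxmod_scaleC.
  rewrite linear_sum mulmx_sum_row; apply: eq_bigr => i _.
  rewrite linearZ /= mxmod_scaleC; apply: (congr1 (fun v : 'rV[Z2]_N => x 0 i *: v)).
  by apply/matrixP => a b; rewrite !mxE [a]ord1.
exists G; split.
  apply/row_matrixP => i; rewrite !rowE !mulmxA -!fE.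
  rewrite -(@mxmod_scale_pi _ _ _ _ sp2) -(@mxmod_scale_pi _ _ _ _ sp1).
  by rewrite linearZ.
apply/matrixP => i j; have := fform (delta_mx 0 i : 'rV_N) (delta_mx 0 j : 'rV_N).
rewrite !mxSkewHermE !fE !trmx_mul trmx_delta !mulmxA -!colE.
by rewrite -!(mulmxA (delta_mx 0 i)) -!rowE !mxE.
Qed.

(** * Matrix pairs of self-dual modules, and the count *)

Lemma restr_scaleE p (M : lmodType (Rp p)) (c : Z2) (x : restr M) :
  c *: x = (c%:A : Rp p) *: (x : M).
Proof. by []. Qed.

(** Self-duality enters through the coordinate functions of the basis: the
    vectors that represent them give the inverse of the Gram matrix. *)
Lemma self_dual_matrix p N (M : skewHermMod p) : self_dual M -> free_of_rank (restr M) N ->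
  exists (J T : 'M[Z2]_N) (sp : skew_pair p J T), sh_iso (mxSkewHerm sp) M.
Proof.
move=> sdM [e eP].
have /choice [c cP] (x : restr M) : exists c : 'rV[Z2]_N, x = \sum_i c 0 i *: e i.
  have [c [xc _]] := eP x; exists (\row_i c i); rewrite {1}xc.
  by apply: eq_bigr => i _; rewrite mxE.
pose v (x : 'rV[Z2]_N) : restr M := \sum_i x 0 i *: e i.
have cK : cancel c v by move=> x; rewrite /v -cP.
have v_inj : injective v.
  move=> x y xy; have [b [_ bU]] := eP (v x).
  have h z : v x = v z -> b = [ffun i => z 0 i].
    by move=> E; apply: bU; rewrite E; apply: eq_bigr => i _; rewrite ffunE.
  have := h x erefl; rewrite (h y xy) => /ffunP xy'.
  by apply/rowP => i; have := xy' i; rewrite !ffunE.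
have vK : cancel v c by move=> x; apply: v_inj; rewrite cK.
have v_linear : linear v.
  move=> a x y; rewrite /v scaler_sumr -big_split; apply: eq_bigr => i _.
  by rewrite !mxE scalerDl scalerA.
have c_linear : linear c.
  by move=> a x y; apply: v_inj; rewrite v_linear !cK.
pose V : {linear 'rV[Z2]_N -> restr M} := HB.pack v (GRing.isLinear.Build _ _ _ _ v v_linear).
have vE x : v x = V x by [].
have v_delta i : v (delta_mx 0 i) = e i.
  rewrite /v (bigD1 i) //= mxE !eqxx scale1r big1 ?addr0 // => j ji.
  by rewrite mxE (negPf ji) andbF scale0r.
pose J : 'M[Z2]_N := \matrix_(i, j) shform M (e i) (e j).
pose T : 'M[Z2]_N := \matrix_i c (Rpi p *: (e i : M) : restr M).
have formE x y : shform M (v x) (v y) = (x *m J *m y^T) 0 0.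
  rewrite {1}/v linear_sumlz /= -mulmxA mxE; apply: eq_bigr => i _.
  rewrite linearZl_LR /= mxE; congr (_ * _).
  rewrite /v linear_sumr; apply: eq_bigr => j _.
  by rewrite linearZr_LR !mxE /= mulrC.
have piE x : v (x *m T) = Rpi p *: (v x : M).
  rewrite mulmx_sum_row vE linear_sum /v scaler_sumr; apply: eq_bigr => i _.
  rewrite linearZ /= rowK cK.
  rewrite !restr_scaleE !scalerA mulrC //.
have eqJ (A B : 'M[Z2]_N) : (forall x y : 'rV_N, (x *m A *m y^T) 0 0 = (x *m B *m y^T) 0 0) -> A = B.
  move=> AB; apply/matrixP => i j; have := AB (delta_mx 0 i) (delta_mx 0 j).
  by rewrite !trmx_delta -!colE -!rowE !mxE.
have sp : skew_pair p J T.
  split.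
  - apply/matrixP => i j; rewrite !mxE; apply/eqP; rewrite -subr_eq0 opprK.
    have := shform_alt (e i + e j : restr M).
    rewrite linearDl /= !linearDr /= !shform_alt add0r addr0 => /eqP.
    by rewrite addrC.
  - apply/row_matrixP => i; rewrite !rowE; apply: v_inj.
    rewrite mulmxA !piE mul_mx_scalar scalerA Rpi_sq [RHS]vE linearZ.
    by [].
  - apply: eqJ => x y.
    rewrite mulmxA -formE piE shform_adj Rconj_pi scaleNr -piE mulmxN mulNmx [RHS]mxE.
    by rewrite mulmxA -(mulmxA _ T^T) -trmx_mul -formE; apply: linearNr.
  - have /choice [k kP] (j : 'I_N) : exists x : restr M, forall y, shform M x y = c y 0 j.
      pose phi (y : restr M) : Z2 := c y 0 j.
      have phi_linear : linear_for *%R phi.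
        by move=> a y z; rewrite /phi c_linear !mxE.
      pose F : {scalar (restr M)} := HB.pack phi (GRing.isLinear.Build _ _ _ _ phi phi_linear).
      by have [x [xE _]] := sdM F; exists x => y; rewrite xE.
    pose K : 'M[Z2]_N := \matrix_i c (k i).
    exists K; apply: mulmx1C; apply/matrixP => i j.
    have := kP i (v (delta_mx 0 j)); rewrite vK -{1}(cK (k i)) formE.
    rewrite trmx_delta -colE -(rowK (fun i => c (k i))) -row_mul !mxE /=.
    by rewrite eq_sym.
exists J, T, sp.
apply: (@sh_iso_intro _ (mxSkewHerm sp) M v).
- apply: Rp_linear => [x y|a x|x].
  + by rewrite !vE linearD.
  + by rewrite mxmod_scaleC vE linearZ.
  + by rewrite mxmod_scale_pi piE.
- by exists c.
- by move=> x y; rewrite formE mxSkewHermE.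
Qed.

Lemma sym_lift n (A : 'M['F_2]_n) : A^T = A ->
  exists B : 'M[Z2]_n, B^T = B /\ map_mx red B = A.
Proof.
move=> AT; exists (map_mx (fun x : 'F_2 => (x : nat)%:R) A); split.
  by rewrite map_trmx AT.
by apply/matrixP => i j; rewrite !mxE red_lift.
Qed.

Theorem theorem1p1 (p : nat) (hp : prime p) (hp7 : p = 7 %[mod 8])
    (n : nat) (hn : (1 <= n)%N) :
  has_num_classes
    (fun M : skewHermMod p => self_dual M /\ free_of_rank (restr M) (2 * n))
    (@sh_iso p)
    (\sum_(0 <= r < n.+1) m_ r)%N.
Proof.
have [s ss] := Z2_sqrt hp7.
(* [s] is a unit because its square is odd. *)
have [s' ss'] : exists s', s * s' = 1.
  apply: Z2_inv; apply/eqP => s0.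
  have /eqP := congr1 red ss; rewrite rmorphM /= s0 mul0r rmorphN rmorph_nat eq_sym oppr_eq0.
  rewrite (_ : p%:R = 1) ?oner_eq0 //.
  have p2 : p = (p./2 * 2).+1 by lia.
  by rewrite p2 mulrSr natrM (_ : 2%:R = 0 :> 'F_2) ?mulr0 ?add0r //; apply/val_inj.
rewrite mul2n -addnn.
have [rep [repT rep_inj rep_surj]] := sym_reps n.
have /choice [B BP] i := sym_lift (repT i).
have sp i : skew_pair p (stdJ n) (stdT s (B i)).
  by apply: std_skew_pair => //; case: (BP i).
exists (fun i => mxSkewHerm (sp i)); split.
- by move=> i; split; [apply: mxSkewHerm_self_dual | apply: mxmod_free].
- move=> i j /sh_iso_mx_isometry [G /(std_isometry_congruent ss')].
  by rewrite (BP i).2 (BP j).2 => /rep_inj.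
- move=> M [sdM /(self_dual_matrix sdM) [J [T [spM isoM]]]].
  have [C [G [CT iG]]] := normal_form ss ss' spM.
  have [i iC] : exists i, congruent_mx (rep i) (map_mx red C).
    by apply: rep_surj; rewrite map_trmx CT.
  exists i; apply: sh_iso_trans isoM.
  have spC : skew_pair p (stdJ n) (stdT s C) by apply: std_skew_pair.
  apply: (sh_iso_trans _ (mx_isometry_sh_iso spC spM iG)).
  have [|G' iG'] := @congruent_std_isometry s s' n (B i) C ss' (BP i).1 CT.
    by rewrite (BP i).2 congruent_mx_sym.
  exact: mx_isometry_sh_iso iG'.
Qed.
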